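(* Let $M$ be a Hermitian symmetric space of noncompact type with reproducing kernel $K_M$, let $M^*$ be its compact dual, and let $K_{M^*}$ be the dual kernel, $K_{M^*}(z,\bar z)=1/K_M(z,-\bar z)$. Then $$K_{M^*}\circ\Psi_M=K_M,$$ i.e. $K_{M^*}\big(\Psi_M(z),\overline{\Psi_M(z)}\big)=K_M(z,\bar z)$ for all $z\in M$, where $\Psi_M:M\to M^*\setminus\operatorname{Cut}_0(M^* )$, $\Psi_M(z)=B(z,z)^{-\frac14}z$, is the symplectic duality map.
   Context: **Jordan triple systems.** A Hermitian Jordan triple system is a complex vector space $\mathcal{M}$ (finite-dimensional) with a map $\{\,,\,,\,\}:\mathcal{M}^3\to\mathcal{M}$, $(u,v,w)\mapsto\{u,v,w\}$, which is $\mathbb{C}$-bilinear and symmetric in $u,w$, $\mathbb{C}$-antilinear in $v$, and satisfies $\{x,y,\{u,v,w\}\}-\{u,v,\{x,y,w\}\}=\{\{x,y,u\},v,w\}-\{u,\{v,x,y\},w\}$. Put $T(x,y)z=\{x,y,z\}$, $Q(x)y=\frac12\{x,y,x\}$, and let the Bergman operator be $B(x,y)=\mathrm{id}_{\mathcal M}-T(x,y)+Q(x)Q(y)$. The system is positive (an HPJTS) if the Hermitian form $(u\mid v)=\operatorname{tr}T(u,v)$ is positive definite. **The space $M$.** To an HPJTS $\mathcal{M}$ corresponds the bounded symmetric domain $M\subset\mathcal{M}$ that is the connected component containing $0$ of the set of $u\in\mathcal{M}$ such that $B(u,u)$ is positive definite with respect to $(\cdot\mid\cdot)$. Every Hermitian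 symmetric space of noncompact type arises this way, and $M$ is always taken in this (circled) realization, with $\mathcal{M}=T_0M\cong\mathbb{C}^n$. For $z\in M$, $B(z,z)$ is positive definite and $B(z,z)^{-1/4}$ is the corresponding power. The reproducing kernel of $M$ (normalized by $K_M(0,0)=1$; holomorphic in the first variable, antiholomorphic in the second) is $K_M(z,\bar w)=1/\det B(z,w)$. For example, for the unit ball $M=\mathbb{C}H^n$, $K_M(z,\bar z)=(1-|z|^2)^{-(n+1)}$. **The compact dual.** $M^*$ is the compact dual of $M$ with base point $0$, and $\operatorname{Cut}_0(M^* )$ is the cut locus of $0$ with respect to the Fubini--Study metric (the pull-back of the Fubini--Study metric of $\mathbb{C}P^N$ under the Borel--Weil embedding). One has the standard (Borel/Harish-Chandra) inclusions $M\subset T_0M=T_0M^*\cong M^*\setminus\operatorname{Cut}_0(M^* )\subset M^*$, where $\cong$ is a biholomorphism fixing $0$ with identity differential at $0$; via it $M^*\setminus\operatorname{Cut}_0(M^* )$ is identified with $\mathcal{M}=\mathbb{C}^n$. The kernel $K_{M^*}(z,\bar z)=1/K_M(z,-\bar z)$ is a function on this chart, where $K_M(z,-\bar z)$ means $K_M(z,\bar w)$ at $w=-z$, so that $K_{M^*}(z,\bar z)=\det B(z,-z)$. For example $K_{M^*}(z,\bar z)=(1+|z|^2)^{n+1}$ for $M=\mathbb{C}H^n$, $M^*=\mathbb{C}P^n$. *)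

(* Defs.v *)
From HB Require Import structures.
From mathcomp Require Import all_boot all_order all_algebra.
From mathcomp Require Import all_classical all_reals all_analysis.
From mathcomp Require Import complex.

Set Implicit Arguments.
Unset Strict Implicit.
Unset Printing Implicit Defensive.

Import Order.TTheory GRing.Theory Num.Theory.
Import numFieldNormedType.Exports.

Local Open Scope classical_set_scope.
Local Open Scope ring_scope.
Local Open Scope complex_scope.

(* R[i] with the topology of its modulus, so that C^n = 'rV[R[i]]_n is a
   topological space. *)
HB.instance Definition _ (R : realType) :=
  PseudoPointedMetric.copy R[i] (R[i])^o.

(* A linear endomorphism f of C^n is represented by lin1_mx f, which acts on
   row vectors on the right: v *m lin1_mx f = f v. *)

Section JordanTripleSystem.
Variables (R : realType) (n : nat).
Local Notation V := 'rV[R[i]]_n.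

Record hermitian_jts (jt : V -> V -> V -> V) : Prop := HermitianJTS {
  jts_linear : forall v w, linear (fun u => jt u v w);
  jts_sym : forall u v w, jt u v w = jt w v u;
  jts_antilinear : forall u w (a : R[i]) v v',
    jt u (a *: v + v') w = a^* *: jt u v w + jt u v' w;
  jts_jordan : forall x y u v w,
    jt x y (jt u v w) - jt u v (jt x y w) =
    jt (jt x y u) v w - jt u (jt v x y) w }.

Variable jt : V -> V -> V -> V.

Definition opT (x y : V) : V -> V := fun z => jt x y z.

Definition opQ (x : V) : V -> V := fun y => 2^-1 *: jt x y x.

Definition bergman (x y : V) : V -> V :=
  fun z => z - opT x y z + opQ x (opQ y z).

Definition trform (u v : V) : R[i] := \tr (lin1_mx (opT u v)).

(* In R[i], 0 < c means that c is real and positive; this is why positive_jts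
   makes trform Hermitian, and why posdef makes a linear f self-adjoint with
   respect to trform. *)
Definition positive_jts : Prop := forall u, u != 0 -> 0 < trform u u.

Definition posdef (f : V -> V) : Prop :=
  forall v, v != 0 -> 0 < trform (f v) v.

Definition symdomain : set V :=
  connected_component [set u | posdef (bergman u u)] 0.

(* The value at (z, w) of the kernel K(z, conj w) of symdomain, normalized by
   K(0, 0) = 1; the formula continues it to all z and w in C^n with
   det B(z, w) != 0. *)
Definition reproducing_kernel (z w : V) : R[i] :=
  (\det (lin1_mx (bergman z w)))^-1.

(* K^*(z, conj z), where C^n is identified with the complement of the cut locus
   of 0 in the compact dual. *)
Definition dual_kernel (z : V) : R[i] := (reproducing_kernel z (- z))^-1.

(* The matrix of f^s, where f is linear and diagonalizable with real positive
   eigenvalues: f^s is the unique linear map that acts as multiplication by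
   l^s on the eigenspace of f for the eigenvalue l, for every l. *)
Definition powmx (f : V -> V) (s : R) : 'M[R[i]]_n :=
  xget 0 [set A | forall (l : R) (v : V),
                    f v = l%:C *: v -> v *m A = (l `^ s)%:C *: v].

Definition symplectic_duality (z : V) : V :=
  z *m powmx (bergman z z) (- 4^-1).

End JordanTripleSystem.

(* Main.v *)
Require Import Defs.
From HB Require Import structures.
From mathcomp Require Import all_boot all_order all_algebra.
From mathcomp Require Import all_classical all_reals all_analysis.
From mathcomp Require Import complex.
From mathcomp Require Import spectral ring.

(** Put [S = T(z,z)/2].  A Jordan triple system is power associative: the odd
    powers [z_i = S^i z] satisfy [T(z_i, z_j) = T(z_(i+j), z)], and all these
    operators commute.  So [z] generates a copy of a one-variable polynomial
    algebra, [p |-> p(S) z], in which [T(p(S) z, q(S) z) = T((pq)(S) z, z)] for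
    real [q].  The operators [F_k = T(z_k, z)] obey the Newton recursion of the
    power sums of two numbers,
    [F_(k+2) = F_0 F_(k+1) - Q F_k] with [Q = Q(z)^2 = (F_0^2 - F_1)/2].
    Hence, on a joint eigenvector of [F_0] and [Q] with eigenvalues [a + b] and
    [a b], the operator [T(p(S) z, z)] is the scalar [a p(a) + b p(b)]
    ([eigen_tmx_zpoly]); the pairs [(a, b)] play the role of the pairs
    [(l_i^2, l_j^2)] attached to the Peirce spaces of a spectral decomposition
    [z = sum l_i c_i], without tripotents being mentioned.  On such a vector

      [B(z,z) = (1 - a)(1 - b)]  and
      [B(w,-w) = (1 + a f(a)^2)(1 + b f(b)^2)]  for [w = f(S) z], [f] real.

    If moreover [f^2 (1 - X) = 1] on the spectrum of [z], the product of the
    two is [1], and therefore [B(w,-w) B(z,z)], all of whose eigenvalues are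
    [1], has determinant [1] ([bergman_zpoly_det]).

    It remains to see that the duality map is of this form.  The trace form
    makes [S] self-adjoint, so [z] is a sum of eigenvectors [u_r] of [S] with
    [r] real, and [B(z,z) u_r = (1 - r)^2 u_r].  Thus [B(z,z)^(-1/4) u_r] is
    [(1 - r)^(-1/2) u_r] as soon as [r < 1], and [f] interpolates
    [(1 - r)^(-1/2)] ([symplectic_duality_zpoly]).

    The inequality [r < 1] is where the connected component of [0] enters:
    positivity of [B(z,z)] alone gives only [r <> 1]
    ([posdef_bergman_eigenvalue]).  Along a connected set an eigenvalue of
    [S - 1] cannot become nonnegative without vanishing
    ([negative_spectrum_connected]), and at [0] all of them are [-1]. *)

Set Implicit Arguments.
Unset Strict Implicit.
Unset Printing Implicit Defensive.

Import Order.TTheory GRing.Theory Num.Theory.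
Import numFieldNormedType.Exports.

Local Open Scope ring_scope.

(** * Common eigenvectors and determinants *)

Lemma det_eigenvalue1 (C : numClosedFieldType) n (M : 'M[C]_n) :
  (forall a, eigenvalue M a -> a = 1) -> \det M = 1.
Proof.
move=> M1; have [rs rsE] := closed_field_poly_normal (char_poly M).
rewrite (monicP (char_poly_monic M)) scale1r in rsE.
have rs1 : rs = nseq n 1.
  have /eqP sz : size rs == n.
    by rewrite -eqSS -(size_prod_XsubC rs id) -rsE size_char_poly.
  rewrite -sz; apply/all_pred1P/allP => r r_rs /=; apply/eqP/M1.
  by rewrite eigenvalue_root_char rsE root_prod_XsubC.
have sg0 : (-1) ^+ n != 0 :> C by rewrite signr_eq0.
apply: (mulfI sg0); rewrite -char_poly_det mulr1 rsE.
by rewrite coef0_prod_XsubC rs1 size_nseq big_nseq iter_mulr_1 expr1n mulr1.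
Qed.

(** A prescribed eigenvalue of [A] can be kept, because the eigenspace is stable
    under everything that commutes with [A]: the common eigenvector is found
    inside it. *)
Lemma common_eigenvector_of (C : numClosedFieldType) n (A : 'M[C]_n) As a :
  eigenvalue A a -> {in A :: As &, forall X Y, comm_mx X Y} ->
  exists v : 'rV_n, [/\ v != 0, v *m A = a *: v
    & forall B, B \in As -> exists b, v *m B = b *: v].
Proof.
move=> a_eigen comm_As; set E := eigenspace A a.
have E_stable B : B \in As -> stablemx E B.
  move=> B_As; apply/comm_mx_stable_eigenspace/comm_As; rewrite !inE ?eqxx //.
  by rewrite B_As orbT.
have [||v v0 /allP vP] :=
    @common_eigenvector C _ [seq restrictmx E B | B <- As].
- by rewrite lt0n mxrank_eq0.
- move=> _ _ /mapP[B B_As ->] /mapP[B' B'_As ->]; rewrite /comm_mx.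
  rewrite -!conjmxM ?inE ?stablemx_row_base ?E_stable //.
  by rewrite comm_As // !inE ?B_As ?B'_As orbT.
exists (v *m row_base E); split.
- by rewrite mulmx_free_eq0 ?row_base_free.
- by apply/eigenspaceP; rewrite mulmx_sub // eq_row_base.
move=> B B_As; have /sub_rVP[b bE] : stablemx (v *m row_base E) B.
  by rewrite -stablemx_restrict ?E_stable // vP // map_f.
by exists b.
Qed.

Lemma common_eigenvector_pair (C : numClosedFieldType) n (A B : 'M[C]_n) a :
  comm_mx A B -> eigenvalue A a ->
  exists v : 'rV_n, exists b, [/\ v != 0, v *m A = a *: v & v *m B = b *: v].
Proof.
move=> AB a_eigen.
have [|v [v0 vA vB]] := @common_eigenvector_of _ _ A [:: B] a a_eigen.
  by move=> X Y; rewrite !inE => /orP[]/eqP-> /orP[]/eqP->.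
by have [b bE] := vB B (mem_head _ _); exists v, b.
Qed.

Lemma sum_product_pair (C : numClosedFieldType) (s p : C) :
  exists a b, s = a + b /\ p = a * b.
Proof.
pose d := sqrtC (s ^+ 2 - 4 * p); exists ((s + d) / 2), ((s - d) / 2).
have d2 : d ^+ 2 = s ^+ 2 - 4 * p by exact: sqrtCK.
split; first by field.
have -> : (s + d) / 2 * ((s - d) / 2) = (s ^+ 2 - d ^+ 2) / 4 by field.
by rewrite d2; field.
Qed.

(** Every eigenspace of [M] is invariant under [T] and [Q], so it contains a
    joint eigenvector of all three; as [M] fixes that vector, its only
    eigenvalue is [1]. Writing the other two eigenvalues as [a + b] and
    [a * b] costs nothing over an algebraically closed field. *)
Lemma det_eq1_joint (C : numClosedFieldType) n (T Q M : 'M[C]_n) :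
  comm_mx T Q -> comm_mx T M -> comm_mx Q M ->
  (forall (v : 'rV_n) a b, v != 0 ->
    v *m T = (a + b) *: v -> v *m Q = (a * b) *: v -> v *m M = v) ->
  \det M = 1.
Proof.
move=> TQ TM QM fixM; apply: det_eigenvalue1 => r r_eigen.
have [|v [v0 vr vTQ]] := @common_eigenvector_of _ _ _ [:: T; Q] r r_eigen.
  by move=> X Y; rewrite !inE => /or3P[]/eqP-> /or3P[]/eqP->.
have [s vT] := vTQ T (mem_head _ _).
have [p vQ] := vTQ Q (mem_last _ [:: Q]).
have [a [b [sE pE]]] := sum_product_pair s p.
rewrite {}sE {s} in vT; rewrite {}pE {p} in vQ.
move/eqP: (fixM v a b v0 vT vQ); rewrite vr -subr_eq0 -{2}(scale1r v) -scalerBl.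
by rewrite scaler_eq0 (negPf v0) orbF subr_eq0 => /eqP.
Qed.

(** With [u = a (x (1 - a) - 1)] and [w = b (y (1 - b) - 1)] the
    left-hand side is [(1 + u)(1 + w)], and [u + w] and [u^2 + w^2]
    determine [u w]. *)
Lemma paired_factors_eq1 (F : numFieldType) (a b x y : F) :
  a * (x * (1 - a) - 1) + b * (y * (1 - b) - 1) = 0 ->
  (a * (x * (1 - a) - 1)) ^+ 2 + (b * (y * (1 - b) - 1)) ^+ 2 = 0 ->
  (1 + a * x) * (1 + b * y) * ((1 - a) * (1 - b)) = 1.
Proof.
set u := a * _; set w := b * _ => e1 e2.
have -> : (1 + a * x) * (1 + b * y) * ((1 - a) * (1 - b)) =
    1 + (u + w) + ((u + w) ^+ 2 - (u ^+ 2 + w ^+ 2)) / 2.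
  by rewrite /u /w; field.
by rewrite e1 e2 expr0n subrr mul0r !addr0.
Qed.

Lemma comm_mxZ (F : fieldType) n (X Y : 'M[F]_n) a :
  comm_mx X Y -> comm_mx X (a *: Y).
Proof. by move=> XY; rewrite /comm_mx -scalemxAr -scalemxAl XY. Qed.

Lemma eigenvalue_subr1 (F : fieldType) n (A : 'M[F]_n.+1) r :
  eigenvalue (A - 1) r = eigenvalue A (r + 1).
Proof.
rewrite /eigenvalue /eigenspace; congr (kermx _ != 0).
by rewrite raddfD /= opprD addrA addrAC.
Qed.

(** * Polynomials in a matrix *)

Lemma linear_poly_sum (F : fieldType) (W : lmodType F) (f : {poly F} -> W) :
  linear f -> forall p, f p = \sum_(i < size p) p`_i *: f 'X^i.
Proof.
move=> lf; pose f' : {linear {poly F} -> W} :=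
  HB.pack f (GRing.isLinear.Build _ _ _ _ f lf).
move=> p; rewrite -[f]/(f' : _ -> _) -{1}(coefK p) poly_def linear_sum.
by apply: eq_bigr => i _; rewrite linearZ.
Qed.

(** Most identities below are linear in one or two polynomial arguments, and
    this reduces them to monomials. *)
Lemma eq_linear_poly (F : fieldType) (W : lmodType F) (f g : {poly F} -> W) :
  linear f -> linear g -> (forall i, f 'X^i = g 'X^i) -> f =1 g.
Proof.
move=> lf lg fg p; rewrite (linear_poly_sum lf) (linear_poly_sum lg).
by apply: eq_bigr => i _; rewrite fg.
Qed.

Lemma eigenvector_horner (F : fieldType) n (A : 'M[F]_n.+1) (v : 'rV_n.+1) r p :
  v *m A = r *: v -> v *m horner_mx A p = p.[r] *: v.
Proof.
move=> vA; apply: (eq_linear_poly (f := fun p => v *m horner_mx A p)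
  (g := fun p => p.[r] *: v)) => [a p1 p2|a p1 p2|i] /=.
- by rewrite linearP /= mulmxDr scalemxAr.
- by rewrite hornerD hornerZ scalerDl scalerA.
rewrite rmorphXn /= horner_mx_X hornerXn; elim: i => [|i IHi].
  by rewrite !expr0 mulmx1 scale1r.
by rewrite exprS -mulmxE mulmxA vA -scalemxAl IHi scalerA exprS.
Qed.

Section Lagrange.
Variables (F : fieldType) (rs : seq F).
Hypothesis uniq_rs : uniq rs.

Definition lagrange_basis r : {poly F} :=
  \prod_(s <- rs | s != r) ((r - s)^-1 *: ('X - s%:P)).

Lemma lagrange_basisE r t : t \in rs -> (lagrange_basis r).[t] = (t == r)%:R.
Proof.
move=> t_rs; rewrite /lagrange_basis horner_prod.
have [->|tr] := eqVneq t r.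
  rewrite big1 // => s sr.
  by rewrite hornerZ hornerXsubC mulVf // subr_eq0 eq_sym.
apply/eqP; rewrite prodf_seq_eq0; apply/hasP; exists t => //.
by rewrite tr hornerZ hornerXsubC subrr mulr0 /=.
Qed.

Definition interpolant (c : F -> F) : {poly F} :=
  \sum_(r <- rs) c r *: lagrange_basis r.

Lemma interpolantE c t : t \in rs -> (interpolant c).[t] = c t.
Proof.
move=> t_rs; rewrite /interpolant horner_sum (bigD1_seq t) //= big_seq_cond.
rewrite big1 ?addr0 => [|s /andP[s_rs st]].
  by rewrite hornerZ lagrange_basisE // eqxx mulr1.
by rewrite hornerZ lagrange_basisE // eq_sym (negPf st) mulr0.
Qed.

(** A polynomial in a matrix killed by a product of distinct linear factors
    depends only on the values of the polynomial at their roots. *)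
Lemma horner_mx_eq0 n (A : 'M[F]_n.+1) p :
  horner_mx A (\prod_(r <- rs) ('X - r%:P)) = 0 ->
  {in rs, forall r, p.[r] = 0} -> horner_mx A p = 0.
Proof.
move=> A0 p0; have all_root : all (root p) rs by apply/allP => r /p0/eqP.
have [|q ->] := uniq_roots_prod_XsubC all_root; first by rewrite uniq_rootsE.
by rewrite rmorphM /= A0 mulr0.
Qed.

End Lagrange.

(** * Linear maps as matrices, and their powers *)

Lemma mul_lin1_mx (F : fieldType) m n (f : 'rV[F]_m -> 'rV[F]_n) v :
  linear f -> v *m lin1_mx f = f v.
Proof.
move=> lf; pose f' : {linear 'rV[F]_m -> 'rV[F]_n} :=
  HB.pack f (GRing.isLinear.Build _ _ _ _ f lf).
exact: (mul_rV_lin1 f').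
Qed.

Lemma lin1_mx_eq (F : fieldType) m n (f : 'rV[F]_m -> 'rV[F]_n) A :
  (forall v, f v = v *m A) -> lin1_mx f = A.
Proof. by move=> fA; apply/matrixP => i j; rewrite !mxE fA -rowE mxE. Qed.

Lemma eq_mulmx_rV (F : fieldType) m n (A B : 'M[F]_(m, n)) :
  (forall v : 'rV_m, v *m A = v *m B) -> A = B.
Proof. by move=> AB; apply/row_matrixP => i; rewrite !rowE AB. Qed.

(** The fourth root of the square is the positive square root because [x > 0];
    for [x = 1 - r] this is where the bound on the spectrum of [z] is
    used. *)
Lemma powR_sqr_quarter (R : realType) (x : R) :
  0 < x -> ((x ^+ 2) `^ (- 4^-1)) ^+ 2 * x = 1.
Proof.
move=> x0; rewrite -[x ^+ 2]powR_mulrn ?ltW // -[_ ^+ 2]powR_mulrn ?powR_ge0 //.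
rewrite -!powRrM (_ : 2%:R * (- 4^-1 * 2%:R) = -1); last by field.
by rewrite powR_inv1 ?ltW // mulVf // gt_eqF.
Qed.

(** A choice of matrix with the required property exists for every linear [f]:
    the polynomial in [f] that interpolates [r |-> (Re r)^s] on the spectrum
    acts on each eigenvector as prescribed. *)
Lemma powmxP (R : realType) n' (f : 'rV[R[i]]_n'.+1 -> 'rV[R[i]]_n'.+1)
    (s l : R) (v : 'rV_n'.+1) :
  linear f -> f v = l%:C%C *: v -> v *m powmx f s = (l `^ s)%:C%C *: v.
Proof.
move=> lf; have vf u : u *m lin1_mx f = f u by rewrite mul_lin1_mx.
have [rs rsE] := closed_field_poly_normal (char_poly (lin1_mx f)).
rewrite (monicP (char_poly_monic _)) scale1r in rsE.
pose g := interpolant (undup rs) (fun r => (complex.Re r `^ s)%:C%C).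
have ex : exists A : 'M[R[i]]_n'.+1, forall (l : R) (v : 'rV_n'.+1),
    f v = l%:C%C *: v -> v *m A = (l `^ s)%:C%C *: v.
  exists (horner_mx (lin1_mx f) g) => {l v} l v fv.
  have [->|v0] := eqVneq v 0; first by rewrite mul0mx scaler0.
  have vl : v *m lin1_mx f = l%:C%C *: v by rewrite vf.
  rewrite (eigenvector_horner _ vl) interpolantE ?undup_uniq // mem_undup.
  rewrite -root_prod_XsubC -rsE -eigenvalue_root_char.
  by apply/eigenvalueP; exists v.
rewrite /powmx; exact: (xgetPex 0 ex).
Qed.

(** * Self-adjoint matrices *)

Section SelfAdjoint.
Variables (C : numClosedFieldType) (n' : nat).
Local Notation n := n'.+1.
Variable h : 'rV[C]_n -> 'rV[C]_n -> C.
Hypothesis h_linear : forall v, linear_for *%R (h^~ v).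
Hypothesis h_antilinear :
  forall u a v v', h u (a *: v + v') = a^* * h u v + h u v'.
Hypothesis h_pos : forall u, u != 0 -> 0 < h u u.

Definition selfadjoint (A : 'M[C]_n) : Prop :=
  forall u v, h (u *m A) v = h u (v *m A).

Let hZl a u v : h (a *: u) v = a * h u v.
Proof.
have h0 : h 0 v = 0.
  by have := h_linear v (-1) 0 0; rewrite scaler0 addr0 mulN1r addNr.
by have := h_linear v a u 0; rewrite !addr0 h0 addr0.
Qed.

Let hDl u u' v : h (u + u') v = h u v + h u' v.
Proof. by have := h_linear v 1 u u'; rewrite scale1r mul1r. Qed.

Let h0r u : h u 0 = 0.
Proof.
by have := h_antilinear u (-1) 0 0; rewrite scaler0 addr0 rmorphN1 mulN1r addNr.
Qed.

Let hZr a u v : h u (a *: v) = a^* * h u v.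
Proof. by have := h_antilinear u a v 0; rewrite !addr0 h0r addr0. Qed.

Let hDr u v v' : h u (v + v') = h u v + h u v'.
Proof. by have := h_antilinear u 1 v v'; rewrite scale1r conjC1 mul1r. Qed.

Lemma selfadjoint_eigenvalue_real A a :
  selfadjoint A -> eigenvalue A a -> a \is Num.real.
Proof.
move=> sA /eigenvalueP[v vA v0]; have := sA v v.
rewrite vA hZl hZr => /(mulIf (lt0r_neq0 (h_pos v0))) aE.
by rewrite CrealE -aE.
Qed.

Lemma selfadjointD A B : selfadjoint A -> selfadjoint B -> selfadjoint (A + B).
Proof. by move=> sA sB u v; rewrite !mulmxDr hDl hDr sA sB. Qed.

Lemma selfadjointZ a A :
  a \is Num.real -> selfadjoint A -> selfadjoint (a *: A).
Proof.
by move=> /CrealP ar sA u v; rewrite -!scalemxAr hZl hZr ar sA.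
Qed.

Lemma selfadjoint1 : selfadjoint 1.
Proof. by move=> u v; rewrite !mulmx1. Qed.

Lemma selfadjoint0 : selfadjoint 0.
Proof. by move=> u v; rewrite !mulmx0 h0r -(scale0r u) hZl mul0r. Qed.

Lemma selfadjointM A B :
  A * B = B * A -> selfadjoint A -> selfadjoint B -> selfadjoint (A * B).
Proof.
move=> AB sA sB u v.
by rewrite {2}AB -!mulmxE !mulmxA sB sA.
Qed.

Lemma selfadjointX A m : selfadjoint A -> selfadjoint (A ^+ m).
Proof.
move=> sA; elim: m => [|m IHm]; first by rewrite expr0; exact: selfadjoint1.
by rewrite exprS; apply: selfadjointM => //; rewrite -exprS -exprSr.
Qed.

Lemma selfadjoint_horner A p :
  map_poly Num.conj p = p -> selfadjoint A -> selfadjoint (horner_mx A p).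
Proof.
move=> p_real sA; rewrite -(coefK p) poly_def rmorph_sum /=.
elim/big_ind: _ => [|X Y|i _]; [exact: selfadjoint0|exact: selfadjointD|].
rewrite linearZ /= rmorphXn /= horner_mx_X.
by apply: selfadjointZ; [rewrite CrealE -coef_map p_real|exact: selfadjointX].
Qed.

Lemma selfadjoint_sqr_eq0 A : selfadjoint A -> A ^+ 2 = 0 -> A = 0.
Proof.
move=> sA A2; apply/row_matrixP => i; rewrite row0 rowE.
apply/eqP/negPn/negP => /h_pos.
by rewrite sA -mulmxA mulmxE -expr2 A2 mulmx0 h0r ltxx.
Qed.

Lemma selfadjoint_nilpotent A m : selfadjoint A -> A ^+ m = 0 -> A = 0.
Proof.
move=> sA Am; have: A ^+ (2 ^ m) = 0.
  by rewrite -(subnK (ltnW (ltn_expl m (ltnSn 1)))) exprD Am mulr0.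
elim: m {Am} => [|m IHm]; first by rewrite expr1.
rewrite expnS mulnC exprM => A2m; apply: IHm.
by apply: selfadjoint_sqr_eq0 => //; apply: selfadjointX.
Qed.

(** The product of the distinct linear factors of the characteristic polynomial,
    taken at [A], is self-adjoint and nilpotent, hence zero. *)
Lemma selfadjoint_annihilator A : selfadjoint A ->
  exists rs : seq C, [/\ uniq rs, {in rs, forall r, eigenvalue A r},
    {subset rs <= Num.real} & horner_mx A (\prod_(r <- rs) ('X - r%:P)) = 0].
Proof.
move=> sA; have [rs rsE] := closed_field_poly_normal (char_poly A).
rewrite (monicP (char_poly_monic A)) scale1r in rsE.
have ev r : r \in undup rs -> eigenvalue A r.
  by rewrite mem_undup eigenvalue_root_char rsE root_prod_XsubC.
have re : {subset undup rs <= Num.real}.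
  by move=> r /ev; exact: selfadjoint_eigenvalue_real.
exists (undup rs); split => //; first exact: undup_uniq.
set p := \prod_(r <- _) _.
apply: (@selfadjoint_nilpotent _ (size rs)).
  apply: selfadjoint_horner => //.
  rewrite rmorph_prod /= big_seq [RHS]big_seq.
  apply: eq_bigr => r /re /CrealP rr.
  by rewrite map_polyXsubC /= rr.
rewrite -rmorphXn /=; have /dvdpP[q ->] : char_poly A %| p ^+ size rs.
  have -> : p ^+ size rs = \prod_(r <- rs) p.
    by rewrite big_const_seq count_predT iter_mulr_1.
  rewrite rsE big_seq [X in _ %| X]big_seq.
  elim/big_ind2: _ => [||r r_rs]; [by []|by move=> *; apply: dvdp_mul|].
  by rewrite dvdp_XsubCl root_prod_XsubC mem_undup.
by rewrite rmorphM /= Cayley_Hamilton mulr0.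
Qed.

End SelfAdjoint.

(** * Identities in a Jordan triple system *)

(** The two hypotheses give [- (p - r) = 2 (p - r)]. *)
Lemma eq_from_exchange (F : numFieldType) (V : lmodType F) (p r w : V) :
  p - r = r - w -> r - p = p - w -> p = r.
Proof.
move=> pr rp; apply/subr0_eq.
have X2 : - (p - r) = (p - r) + (p - r) by rewrite {3}pr subrKA opprB.
have /eqP : (3 : F) *: (p - r) = 0.
  rewrite (_ : 3 = 1 + 1 + 1 :> F); last by ring.
  by rewrite 2!scalerDl scale1r -X2 addNr.
by rewrite scaler_eq0 (pnatr_eq0 F 3) => /eqP.
Qed.

Section Jordan.
Variables (R : realType) (n' : nat).
Local Notation n := n'.+1.
Local Notation C := (R[i]).
Local Notation V := ('rV[R[i]]_n'.+1).
Variable jt : V -> V -> V -> V.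
Hypothesis jtP : hermitian_jts jt.

Lemma jtDl x x' y z : jt (x + x') y z = jt x y z + jt x' y z.
Proof. by have := jts_linear jtP y z 1 x x'; rewrite !scale1r. Qed.
Lemma jtDr x y z z' : jt x y (z + z') = jt x y z + jt x y z'.
Proof. by rewrite (jts_sym jtP) jtDl 2![jt _ y x](jts_sym jtP). Qed.
Lemma jtDm x y y' z : jt x (y + y') z = jt x y z + jt x y' z.
Proof.
by have := jts_antilinear jtP x z 1 y y'; rewrite rmorph1 !scale1r.
Qed.
Lemma jt0l y z : jt 0 y z = 0.
Proof. by apply: (addrI (jt 0 y z)); rewrite -jtDl !addr0. Qed.
Lemma jt0m x z : jt x 0 z = 0.
Proof. by apply: (addrI (jt x 0 z)); rewrite -jtDm !addr0. Qed.
Lemma jtZl a x y z : jt (a *: x) y z = a *: jt x y z.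
Proof. by have := jts_linear jtP y z a x 0; rewrite !addr0 jt0l addr0. Qed.
Lemma jtZr a x y z : jt x y (a *: z) = a *: jt x y z.
Proof. by rewrite (jts_sym jtP) jtZl [jt z _ _](jts_sym jtP). Qed.
Lemma jtZm (a : C) x y z : jt x (a *: y) z = Num.conj a *: jt x y z.
Proof.
by have := jts_antilinear jtP x z a y 0; rewrite !addr0 jt0m addr0.
Qed.
Lemma jtNm x y z : jt x (- y) z = - jt x y z.
Proof. by rewrite -scaleN1r jtZm rmorphN1 scaleN1r. Qed.

Definition tmx (u v : V) : 'M[C]_n := lin1_mx (opT jt u v).

Lemma mul_tmx u v w : w *m tmx u v = jt u v w.
Proof.
by rewrite mul_lin1_mx // => a x y; rewrite /opT jtDr jtZr.
Qed.

Lemma tmx0l v : tmx 0 v = 0.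
Proof. by apply: eq_mulmx_rV => w; rewrite mulmx0 mul_tmx jt0l. Qed.
Lemma tmx0r u : tmx u 0 = 0.
Proof. by apply: eq_mulmx_rV => w; rewrite mulmx0 mul_tmx jt0m. Qed.
Lemma tmxDl u u' v : tmx (u + u') v = tmx u v + tmx u' v.
Proof. by apply: eq_mulmx_rV => w; rewrite mulmxDr !mul_tmx jtDl. Qed.
Lemma tmxZl a u v : tmx (a *: u) v = a *: tmx u v.
Proof. by apply: eq_mulmx_rV => w; rewrite -scalemxAr !mul_tmx jtZl. Qed.
Lemma tmxDr u v v' : tmx u (v + v') = tmx u v + tmx u v'.
Proof. by apply: eq_mulmx_rV => w; rewrite mulmxDr !mul_tmx jtDm. Qed.
Lemma tmxZr (a : C) u v : tmx u (a *: v) = Num.conj a *: tmx u v.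
Proof. by apply: eq_mulmx_rV => w; rewrite -scalemxAr !mul_tmx jtZm. Qed.

(** The Jordan identity as a commutator formula. Matrices act on the right, so
    the order of the factors is reversed. *)
Lemma tmx_comm x y u v :
  tmx u v * tmx x y - tmx x y * tmx u v = tmx (jt x y u) v - tmx u (jt v x y).
Proof.
apply: eq_mulmx_rV => w.
by rewrite !mulmxBr -!mulmxE !mulmxA !mul_tmx (jts_jordan jtP).
Qed.

(** The Jordan identity relates the three expressions [{x,y,{x,b,x}}],
    [{{x,y,x},b,x}] and [{x,{b,x,y},x}]; exchanging [y] and [b] swaps the first
    two and fixes the third. *)
Lemma jt_shift x y b :
  jt x y (jt x b x) = jt (jt x y x) b x.
Proof.
have E y' b' : jt x y' (jt x b' x) - jt x b' (jt x y' x) =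
    jt (jt x y' x) b' x - jt x (jt b' x y') x by exact: (jts_jordan jtP).
apply: (@eq_from_exchange C _ _ _ (jt x (jt b x y) x)).
  by rewrite -E (jts_sym jtP _ b).
by rewrite {1}(jts_sym jtP _ b) E (jts_sym jtP b) (jts_sym jtP _ y).
Qed.

(** This expresses [Q(u,w) Q(y)] through the operators [T]; with
    [u = w = x] it is
    [4 Q(x) Q(y) = 2 T(x,y)^2 - T({x,y,x}, y)]. *)
Lemma jt_middle u y b w :
  jt u (jt y b y) w =
  jt w y (jt u y b) + jt u y (jt w y b) - jt (jt u y w) y b.
Proof.
rewrite (jts_sym jtP w) (jts_sym jtP u y b) (jts_sym jtP w y b).
rewrite (jts_sym jtP _ y b) -addrA -[_ - jt b y _]opprB (jts_jordan jtP).
by rewrite opprB addrC subrK.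
Qed.

(** * Odd powers of an element *)

Section Powers.
Variable z : V.

(** With this factor the cube of [z] is [Q(z) z = z *m half_tmx]. *)
Definition half_tmx : 'M[C]_n := 2^-1 *: tmx z z.
(** [odd_power i] is the Jordan power of [z] of exponent [2 i + 1]. *)
Definition odd_power i : V := z *m half_tmx ^+ i.
Local Notation zp := odd_power.
Local Notation F i := (tmx (odd_power i) z).

Lemma odd_power0 : zp 0 = z. Proof. by rewrite /odd_power expr0 mulmx1. Qed.

Lemma tmx_half : tmx z z = 2 *: half_tmx.
Proof. by rewrite scalerA divff ?scale1r // pnatr_eq0. Qed.

Lemma jt_odd_powerS i : jt z z (zp i) = 2 *: zp i.+1.
Proof.
by rewrite -mul_tmx tmx_half -scalemxAr /odd_power exprSr -mulmxE mulmxA.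
Qed.

Let conj2 : Num.conj (2 : C) = 2. Proof. exact: conjC_nat. Qed.

Lemma tmx_half_comm i j :
  tmx (zp i) (zp j) * tmx z z - tmx z z * tmx (zp i) (zp j) =
  2 *: (tmx (zp i.+1) (zp j) - tmx (zp i) (zp j.+1)).
Proof.
rewrite tmx_comm [jt (zp j) _ _](jts_sym jtP) !jt_odd_powerS.
by rewrite tmxZl tmxZr conj2 scalerBr.
Qed.

(** Let [L] be the commutator. The differences
    [T(z_(i+1), z_j) - T(z_i, z_(j+1))] with [i + j = m] all equal
    [L / 2], so [T(z_(m+1), z) - T(z, z_(m+1)) = (m + 1) L / 2].
    The same commutator, expanded with the roles of the two factors exchanged,
    is [-2] times this difference; hence [(m + 2) L = 0]. *)
Lemma tmx_odd_power_step m :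
  (forall i j, (i + j <= m)%N -> tmx (zp i) (zp j) = F (i + j)) ->
  F m * tmx z z - tmx z z * F m = 0.
Proof.
move=> IH; set L := _ - _.
have K i j : (i + j = m)%N ->
    tmx (zp i.+1) (zp j) - tmx (zp i) (zp j.+1) = 2^-1 *: L.
  move=> ij; rewrite /L -ij -IH ?ij //.
  by rewrite tmx_half_comm scalerA mulVf ?scale1r //.
(* The case k = m + 1 is the sum of all the differences. *)
have telescope k : (k <= m.+1)%N ->
    tmx (zp m.+1) z - tmx (zp (m.+1 - k)) (zp k) = k%:R *: (2^-1 *: L).
  elim: k => [|k IHk] km; first by rewrite subn0 odd_power0 subrr scale0r.
  rewrite -(subrKA (tmx (zp (m.+1 - k)) (zp k))) IHk ?(ltnW km) // subSS.
  rewrite subSn -1?ltnS // K ?subnK // -?ltnS //.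
  by rewrite -(natr1 k) scalerDl scale1r.
have jtm : jt z (zp m) z = jt (zp m) z z.
  by rewrite -!mul_tmx -[X in tmx X (zp m)]odd_power0 IH.
have := tmx_comm (zp m) z z z.
rewrite jtm (jts_sym jtP) jt_odd_powerS tmxZl tmxZr conj2 -scalerBr.
have := telescope m.+1 (leqnn _); rewrite subnn odd_power0 => -> LE.
have /eqP : m.+2%:R *: L = 0.
  rewrite -(natr1 m.+1) scalerDl scale1r; apply/eqP; rewrite addr_eq0.
  by rewrite opprB LE !scalerA mulrCA divff ?mulr1 //.
by rewrite scaler_eq0 pnatr_eq0 /= => /eqP.
Qed.

(** Power associativity, by induction on [i + j]: once the operator of level
    [m] commutes with [T(z,z)], all operators of level [m + 1] agree. *)
Lemma tmx_odd_powers i j : tmx (zp i) (zp j) = F (i + j).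
Proof.
move: {2}(i + j)%N (leqnn (i + j)) => m; elim: m i j => [|m IHm] i j.
  by rewrite leqn0 addn_eq0 => /andP[/eqP-> /eqP->]; rewrite odd_power0.
rewrite leq_eqVlt ltnS => /orP[/eqP|]; last exact: IHm.
elim: j i => [|j IHj] i ij; first by rewrite odd_power0 addn0.
rewrite addnS -addSn -IHj ?addSn -?addnS //.
apply/eqP; rewrite eq_sym -subr_eq0.
have ijm : (i + j)%N = m by apply: succn_inj; rewrite -addnS.
have /eqP := tmx_half_comm i j; rewrite IHm ?ijm // tmx_odd_power_step //.
by rewrite eq_sym scaler_eq0 pnatr_eq0.
Qed.

Lemma tmx_odd_power_comm_half i : F i * half_tmx = half_tmx * F i.
Proof.
apply/subr0_eq; rewrite -scalerAl -scalerAr -scalerBr.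
by rewrite tmx_odd_power_step ?scaler0 // => *; exact: tmx_odd_powers.
Qed.

Lemma mul_odd_power_tmx k i : zp k *m F i = 2 *: zp (i + k).+1.
Proof.
have E : half_tmx ^+ k *m F i = F i *m half_tmx ^+ k.
  by rewrite mulmxE; apply/esym/commrX/tmx_odd_power_comm_half.
rewrite /odd_power -mulmxA -/(zp i) E mulmxA mul_tmx (jts_sym jtP).
by rewrite jt_odd_powerS -scalemxAl -mulmxA mulmxE -exprD addSn.
Qed.

Lemma tmx_odd_power_comm i j : F i * F j = F j * F i.
Proof.
apply/subr0_eq; rewrite tmx_comm -!mul_tmx.
rewrite mul_odd_power_tmx -[X in tmx X (zp j)]odd_power0 tmx_odd_powers add0n.
rewrite -[X in X *m F j]odd_power0.
rewrite mul_odd_power_tmx tmxZl tmxZr conj2 tmx_odd_powers addn0 addnS addnC.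
by rewrite subrr.
Qed.

(** For real [p], the value at [z] of the odd polynomial [p(x^2) x]. *)
Definition zpoly p : V := z *m horner_mx half_tmx p.
Local Notation Fp p := (tmx (zpoly p) z).

Lemma zpoly_linear : linear zpoly.
Proof.
by move=> a p q; rewrite /zpoly linearP /= mulmxDr scalemxAr.
Qed.

Lemma zpolyXn i : zpoly 'X^i = zp i.
Proof. by rewrite /zpoly rmorphXn /= horner_mx_X. Qed.

Lemma tmx_zpoly_linear : linear (fun p => Fp p).
Proof. by move=> a p q; rewrite zpoly_linear tmxDl tmxZl. Qed.

(** The conjugate accounts for the antilinearity of [T] in its second
    argument. *)
Lemma tmx_zpolys p q : tmx (zpoly p) (zpoly (map_poly Num.conj q)) = Fp (p * q).
Proof.
apply: (eq_linear_poly
  (f := fun q => tmx (zpoly p) (zpoly (map_poly Num.conj q)))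
  (g := fun q => Fp (p * q))) => [a q1 q2|a q1 q2|j] /=.
- by rewrite rmorphD /= linearZ /= zpoly_linear tmxDr tmxZr conjCK.
- by rewrite mulrDr -scalerAr tmx_zpoly_linear.
rewrite map_polyXn zpolyXn.
apply: (eq_linear_poly (f := fun p => tmx (zpoly p) (zp j))
  (g := fun p => Fp (p * 'X^j))) => [a q1 q2|a q1 q2|i] /=.
- by rewrite zpoly_linear tmxDl tmxZl.
- by rewrite mulrDl -scalerAl tmx_zpoly_linear.
by rewrite -exprD !zpolyXn tmx_odd_powers.
Qed.

Lemma mul_zpoly_tmx p q : zpoly p *m Fp q = 2 *: zpoly ('X * q * p).
Proof.
apply: (eq_linear_poly (f := fun p => zpoly p *m Fp q)
  (g := fun p => 2 *: zpoly ('X * q * p))) => [a q1 q2|a q1 q2|i] /=.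
- by rewrite zpoly_linear mulmxDl -scalemxAl.
- by rewrite mulrDr -scalerAr zpoly_linear scalerDr !scalerA [a * 2]mulrC.
apply: (eq_linear_poly (f := fun q => zpoly 'X^i *m Fp q)
  (g := fun q => 2 *: zpoly ('X * q * 'X^i))) => [a q1 q2|a q1 q2|j] /=.
- by rewrite tmx_zpoly_linear mulmxDr -scalemxAr.
- rewrite mulrDr mulrDl -scalerAr -scalerAl zpoly_linear scalerDr !scalerA.
  by rewrite [a * 2]mulrC.
by rewrite -exprS -exprD !zpolyXn mul_odd_power_tmx addSn.
Qed.

(** The matrix of [Q(z)^2], see [jt_qmx]. *)
Definition qmx : 'M[C]_n := 2^-1 *: (tmx z z ^+ 2 - F 1).

Lemma jt_qmx b : jt z (jt z b z) z = 4 *: (b *m qmx).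
Proof.
rewrite jt_middle // /qmx -scalemxAr scalerA.
have -> : 4 / 2 = 2 :> C.
  by rewrite (natrM _ 2 2) mulfK // pnatr_eq0.
rewrite mulmxBr expr2 -mulmxE mulmxA !mul_tmx.
have -> : jt z z z = 2 *: zp 1.
  by rewrite -[X in jt z z X]odd_power0 jt_odd_powerS.
by rewrite jtZl scalerBr [2 *: jt z z _]scaler_nat mulr2n.
Qed.

Lemma jt_odd_power k : jt z (zp k) z = 2 *: zp k.+1.
Proof.
rewrite -mul_tmx -[X in tmx X _]odd_power0 tmx_odd_powers.
by rewrite -[X in X *m _]odd_power0 mul_odd_power_tmx addn0.
Qed.

(** Apply [jt_shift] with [b] replaced by [{z,b,z}] and expand both sides by
    [jt_middle]. *)
Lemma tmx_newton k : F k.+2 = tmx z z * F k.+1 - qmx * F k.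
Proof.
suff -> : qmx * F k = tmx z z * F k.+1 - F k.+2 by rewrite opprB addrC subrK.
apply: eq_mulmx_rV => b; rewrite mulmxBr -!mulmxE !mulmxA.
have nz4 : 4 != 0 :> C by rewrite pnatr_eq0.
apply: (scalerI nz4); rewrite scalemxAl -jt_qmx.
have -> : F k = tmx z (zp k).
  by rewrite -[X in tmx X (zp k)]odd_power0 tmx_odd_powers.
rewrite mul_tmx jt_shift // jt_odd_power jtZl // jt_middle //.
rewrite [jt _ z z](jts_sym jtP) jt_odd_powerS jtZl // -!mul_tmx.
rewrite -!mulmxA !mulmxE.
have -> : F k.+1 * tmx z z = tmx z z * F k.+1.
  by have := tmx_odd_power_comm k.+1 0; rewrite odd_power0.
have -> : 4 = 2 * 2 :> C by rewrite -natrM.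
rewrite -scalerA [in RHS]scalerBr.
by rewrite [2 *: (b *m (tmx z z * _))]scaler_nat mulr2n.
Qed.

End Powers.

End Jordan.

(** * Bergman operators *)

Section Bergman.
Variables (R : realType) (n' : nat).
Local Notation n := n'.+1.
Local Notation C := (R[i]).
Local Notation V := ('rV[R[i]]_n'.+1).
Variable jt : V -> V -> V -> V.
Hypothesis jtP : hermitian_jts jt.

Lemma conjC_half : Num.conj (2^-1 : C) = 2^-1.
Proof. by rewrite fmorphV; congr _^-1; exact: conjC_nat. Qed.

Lemma half_half : 2^-1 * 2^-1 = 4^-1 :> C.
Proof. by field. Qed.

Lemma quarter_double : 4^-1 * 2 = 2^-1 :> C.
Proof. by field. Qed.

Lemma bergmanE x y v : bergman jt x y v = v *m
  (1 - tmx jt x y + 4^-1 *: (2 *: tmx jt x y ^+ 2 - tmx jt (jt x y x) y)).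
Proof.
rewrite /bergman /opT /opQ.
rewrite mulmxDr mulmxBr mulmx1 mul_tmx // -scalemxAr mulmxBr -scalemxAr.
rewrite expr2 -mulmxE mulmxA !mul_tmx // (jtZm jtP) scalerA.
rewrite conjC_half half_half.
by rewrite (jt_middle jtP) scaler_nat mulr2n.
Qed.

Lemma bergman_mxE x y : lin1_mx (bergman jt x y) =
  1 - tmx jt x y + 4^-1 *: (2 *: tmx jt x y ^+ 2 - tmx jt (jt x y x) y).
Proof. by apply: lin1_mx_eq => v; exact: bergmanE. Qed.

Lemma bergman_linear x y : linear (bergman jt x y).
Proof. by move=> a u v; rewrite !bergmanE mulmxDl scalemxAl. Qed.

Lemma zpolyM z p q :
  zpoly jt z (p * q) = zpoly jt z p *m horner_mx (half_tmx jt z) q.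
Proof. by rewrite /zpoly rmorphM -mulmxE mulmxA. Qed.

Section Point.
Variable z : V.
Local Notation F i := (tmx jt (odd_power jt z i) z).
Local Notation T0 := (tmx jt z z).
Local Notation Q := (qmx jt z).
Local Notation zpoly := (zpoly jt z).

Lemma tmx_qmx_comm i : F i * Q = Q * F i.
Proof.
rewrite /qmx -scalerAr -scalerAl; congr (_ *: _).
have T0E : T0 = F 0 by rewrite odd_power0.
have FE := tmx_odd_power_comm jtP z i.
by rewrite mulrBr mulrBl T0E expr2 mulrA !FE -mulrA FE mulrA.
Qed.

Lemma bergman_diag : lin1_mx (bergman jt z z) = 1 - T0 + Q.
Proof.
rewrite bergman_mxE -[X in jt z z X](odd_power0 jt z) (jt_odd_powerS jtP).
by rewrite (tmxZl jtP) -scalerBr scalerA quarter_double.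
Qed.

(** The operators [T(z_k, z)] satisfy the recursion of the power sums
    [a^(k+1) + b^(k+1)], with the same first two terms. *)
Lemma eigen_tmx_zpoly (v : V) a b p :
  v *m T0 = (a + b) *: v -> v *m Q = (a * b) *: v ->
  v *m tmx jt (zpoly p) z = (a * p.[a] + b * p.[b]) *: v.
Proof.
move=> vT vQ.
apply: (eq_linear_poly (f := fun p => v *m tmx jt (zpoly p) z)
  (g := fun p => (a * p.[a] + b * p.[b]) *: v)) => [c p1 p2|c p1 p2|i] /=.
- by rewrite tmx_zpoly_linear // mulmxDr -scalemxAr.
- rewrite (_ : _ + _ =
    c * (a * p1.[a] + b * p1.[b]) + (a * p2.[a] + b * p2.[b])).
    by rewrite [LHS]scalerDl; congr (_ + _); apply/esym/scalerA.
  by rewrite !hornerD !hornerZ; ring.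
rewrite zpolyXn !hornerXn.
suff [] : v *m F i = (a * a ^+ i + b * b ^+ i) *: v /\
    v *m F i.+1 = (a * a ^+ i.+1 + b * b ^+ i.+1) *: v by [].
elim: i => [|i [IH1 IH2]].
  rewrite odd_power0 !expr0 !mulr1 vT; split=> //.
  have -> : F 1 = T0 ^+ 2 - 2 *: Q.
    by rewrite /qmx scalerA divff ?pnatr_eq0 // scale1r opprB addrC subrK.
  rewrite mulmxBr expr2 -mulmxE mulmxA vT -scalemxAl vT -scalemxAr vQ.
  by rewrite !scalerA -scalerBl; congr (_ *: _); ring.
split=> //; rewrite tmx_newton // mulmxBr -!mulmxE !mulmxA vT vQ.
rewrite -!scalemxAl IH1 IH2 !scalerA -scalerBl; congr (_ *: _).
by rewrite !exprS; ring.
Qed.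

Lemma eigen_bergman (v : V) a b :
  v *m T0 = (a + b) *: v -> v *m Q = (a * b) *: v ->
  v *m lin1_mx (bergman jt z z) = ((1 - a) * (1 - b)) *: v.
Proof.
move=> vT vQ; rewrite bergman_diag mulmxDr mulmxBr vT vQ mulmx1.
by rewrite -{1}(scale1r v) -scalerBl -scalerDl; congr (_ *: _); ring.
Qed.

(** Only the square of [f] matters, because [T(f(S) z, f(S) z)] depends on
    the product of the two arguments in the algebra generated by [z]. *)
Lemma bergman_zpoly f : map_poly Num.conj f = f ->
  lin1_mx (bergman jt (zpoly f) (- zpoly f)) =
  1 + tmx jt (zpoly (f ^+ 2)) z + 2^-1 *:
    (tmx jt (zpoly (f ^+ 2)) z ^+ 2 - tmx jt (zpoly ('X * f ^+ 4)) z).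
Proof.
move=> f_real; have Tneg u : tmx jt u (- zpoly f) = - tmx jt u (zpoly f).
  by rewrite -scaleN1r tmxZr // rmorphN1 scaleN1r.
have T2 : tmx jt (zpoly f) (zpoly f) = tmx jt (zpoly (f ^+ 2)) z.
  by rewrite -{2}f_real tmx_zpolys // expr2.
rewrite bergman_mxE !Tneg T2 opprK sqrrN (jtNm jtP) -(mul_tmx jtP) T2.
rewrite (mul_zpoly_tmx jtP) -scaleNr (tmxZl jtP).
rewrite -{5}f_real (tmx_zpolys jtP).
rewrite -!(mulrA 'X) -!exprSr opprK scaleNr -scalerBr scalerA.
by rewrite quarter_double.
Qed.

Lemma eigen_bergman_zpoly (v : V) a b f : map_poly Num.conj f = f ->
  v *m T0 = (a + b) *: v -> v *m Q = (a * b) *: v ->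
  v *m lin1_mx (bergman jt (zpoly f) (- zpoly f)) =
  ((1 + a * f.[a] ^+ 2) * (1 + b * f.[b] ^+ 2)) *: v.
Proof.
move=> f_real vT vQ; rewrite bergman_zpoly // 2!mulmxDr mulmx1.
have := eigen_tmx_zpoly ('X * f ^+ 4) vT vQ.
have := eigen_tmx_zpoly (f ^+ 2) vT vQ.
set A := tmx _ (zpoly (f ^+ 2)) z; set B := tmx _ _ z => vA vB.
rewrite -scalemxAr mulmxBr expr2 -mulmxE mulmxA vA -scalemxAl vA vB.
rewrite scalerA -scalerBl scalerA -{1}(scale1r v) -!scalerDl; congr (_ *: _).
by rewrite ?horner_exp !hornerM !hornerX ?horner_exp; field.
Qed.

Lemma comm_tmx_zpoly X p :
  (forall i, comm_mx X (F i)) -> comm_mx X (tmx jt (zpoly p) z).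
Proof.
move=> XF; apply: (eq_linear_poly (f := fun p => X *m tmx jt (zpoly p) z)
  (g := fun p => tmx jt (zpoly p) z *m X)) => [a q1 q2|a q1 q2|i] /=.
- by rewrite tmx_zpoly_linear // mulmxDr -scalemxAr.
- by rewrite tmx_zpoly_linear // mulmxDl -scalemxAl.
by rewrite zpolyXn XF.
Qed.

Lemma comm_qmx X : (forall i, comm_mx X (F i)) -> comm_mx X Q.
Proof.
move=> XF; have XT : comm_mx X T0 by have := XF 0; rewrite odd_power0.
by rewrite /qmx expr2; apply/comm_mxZ/comm_mxB; [exact: comm_mxM|exact: XF].
Qed.

Lemma comm_tmx_qmx : comm_mx T0 Q.
Proof.
apply: comm_qmx => i.
by have := tmx_odd_power_comm jtP z 0 i; rewrite odd_power0.
Qed.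

Lemma comm_bergman_product X f : map_poly Num.conj f = f ->
  (forall i, comm_mx X (F i)) ->
  comm_mx X (lin1_mx (bergman jt (zpoly f) (- zpoly f)) *m
             lin1_mx (bergman jt z z)).
Proof.
move=> f_real XF; have XT : comm_mx X T0 by have := XF 0; rewrite odd_power0.
have X1 : comm_mx X 1 := comm_mx1 X.
rewrite bergman_diag (bergman_zpoly f_real); apply: comm_mxM; last first.
  by apply: comm_mxD; [exact: comm_mxB|exact: comm_qmx].
have XZ p : comm_mx X (tmx jt (zpoly p) z) by exact: comm_tmx_zpoly.
have := XZ (f ^+ 2); have := XZ ('X * f ^+ 4).
move: (tmx _ (zpoly (f ^+ 2)) z) (tmx _ (zpoly _) z) => A B XB XA.
rewrite expr2; apply: comm_mxD; first exact: comm_mxD.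
by apply/comm_mxZ/comm_mxB; [exact: comm_mxM|].
Qed.

(** On a joint eigenvector the hypothesis gives [a q(a) + b q(b) = 0] for
    [q = f^2 (1 - X) - 1] and for its multiples, which is what
    [paired_factors_eq1] needs. *)
Lemma bergman_zpoly_det f : map_poly Num.conj f = f ->
  zpoly (f ^+ 2 * (1 - 'X) - 1) = 0 ->
  \det (lin1_mx (bergman jt (zpoly f) (- zpoly f))) *
  \det (lin1_mx (bergman jt z z)) = 1.
Proof.
move=> f_real; set q := _ - 1 => zq0; rewrite -det_mulmx.
have TF i : comm_mx T0 (F i).
  by have := tmx_odd_power_comm jtP z 0 i; rewrite odd_power0.
have QF i : comm_mx Q (F i) by apply/esym; exact: tmx_qmx_comm.
apply: (det_eq1_joint comm_tmx_qmx) => [||v a b v0 vT vQ].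
- exact: comm_bergman_product f_real TF.
- exact: comm_bergman_product f_real QF.
have zero p : zpoly p = 0 -> a * p.[a] + b * p.[b] = 0.
  move=> p0; have := eigen_tmx_zpoly p vT vQ.
  have -> : tmx jt (zpoly p) z = 0.
    by rewrite p0 (tmx0l jtP).
  by rewrite mulmx0 => /esym/eqP; rewrite scaler_eq0 (negPf v0) orbF => /eqP.
have qE x : q.[x] = f.[x] ^+ 2 * (1 - x) - 1.
  rewrite /q hornerD hornerN hornerM hornerD hornerN hornerX horner_exp.
  by rewrite hornerC.
have e1 := zero _ zq0.
have e2 := zero (q * ('X * q)); rewrite zpolyM zq0 mul0mx in e2.
rewrite mulmxA (eigen_bergman_zpoly f_real vT vQ) -scalemxAl.
rewrite (eigen_bergman vT vQ) scalerA -[RHS]scale1r; congr (_ *: _).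
apply: paired_factors_eq1; rewrite -!qE //.
by rewrite -(e2 erefl) !hornerM !hornerX; ring.
Qed.

End Point.
End Bergman.

(** * The positive trace form *)

Section Positive.
Variables (R : realType) (n' : nat).
Local Notation C := (R[i]).
Local Notation V := ('rV[R[i]]_n'.+1).
Variable jt : V -> V -> V -> V.
Hypothesis jtP : hermitian_jts jt.
Hypothesis jt_pos : positive_jts jt.
Local Notation h := (trform jt).

Lemma trformE u v : h u v = \tr (tmx jt u v). Proof. by []. Qed.

Lemma trform_linear v : linear_for *%R (h^~ v).
Proof.
by move=> a u u'; rewrite !trformE (tmxDl jtP) (tmxZl jtP) mxtraceD mxtraceZ.
Qed.

Lemma trform_antilinear u (a : C) v v' :
  h u (a *: v + v') = Num.conj a * h u v + h u v'.
Proof. by rewrite !trformE (tmxDr jtP) (tmxZr jtP) mxtraceD mxtraceZ. Qed.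

(** The difference of the two sides is the trace of a commutator. *)
Lemma trform_adjoint u v x y : h (u *m tmx jt x y) v = h u (v *m tmx jt y x).
Proof.
rewrite !(mul_tmx jtP) !trformE; apply/eqP; rewrite -subr_eq0 -raddfB /=.
rewrite [jt y x v](jts_sym jtP) -(tmx_comm jtP) raddfB /=.
by rewrite -!mulmxE mxtrace_mulC subrr.
Qed.

Lemma selfadjoint_odd_power z i : selfadjoint h (tmx jt (odd_power jt z i) z).
Proof.
move=> u v; rewrite trform_adjoint; congr (h u (v *m _)).
by rewrite -[X in tmx jt X _](odd_power0 jt z) (tmx_odd_powers jtP).
Qed.

Lemma selfadjoint_half_tmx z : selfadjoint h (half_tmx jt z).
Proof.
apply: (selfadjointZ trform_linear trform_antilinear).
  by rewrite CrealE; apply/eqP; exact: conjC_half.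
by have := selfadjoint_odd_power z 0; rewrite odd_power0.
Qed.

Lemma half_tmx_annihilator z : exists rs : seq C,
  [/\ uniq rs, {in rs, forall r, eigenvalue (half_tmx jt z) r},
    {subset rs <= Num.real} &
    horner_mx (half_tmx jt z) (\prod_(r <- rs) ('X - r%:P)) = 0].
Proof.
exact: (selfadjoint_annihilator trform_linear trform_antilinear jt_pos
  (selfadjoint_half_tmx z)).
Qed.

(** Suppose [1] is an eigenvalue and take a joint eigenvector with [Q(z)^2], of
    eigenvalues [a + b = 2] and [p = a b]. Positivity of [B(z,z)], which
    is [p - 1] there, gives [a b > 1], so [a] and [b] are distinct and not
    real. But [a] must be a root of the minimal polynomial of [S], whose roots
    are real: since [m(S) z = 0], the value of [x |-> (x - b) m(x)] on
    this eigenvector, [a (a - b) m(a)], vanishes. *)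
Lemma posdef_bergman_eigenvalue z :
  posdef jt (bergman jt z z) -> ~~ eigenvalue (half_tmx jt z) 1.
Proof.
move=> Bpos; apply/negP => S1.
have SQ : comm_mx (half_tmx jt z) (qmx jt z).
  by apply/comm_mx_sym/comm_mxZ/comm_mx_sym; exact: comm_tmx_qmx.
have [v [p [v0 vS vQ]]] := common_eigenvector_pair SQ S1.
rewrite scale1r in vS.
have vT : v *m tmx jt z z = 2 *: v by rewrite tmx_half -scalemxAr vS.
have p_gt1 : 1 < p.
  have := Bpos v v0; have -> : bergman jt z z v = (p - 1) *: v.
    rewrite -(mul_lin1_mx _ (bergman_linear jtP z z)) bergman_diag // mulmxDr.
    rewrite mulmxBr mulmx1 vT vQ scalerBl scale1r scaler_nat mulr2n opprD.
    by rewrite addrA subrr add0r addrC.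
  rewrite trformE (tmxZl jtP) mxtraceZ -trformE.
  by rewrite pmulr_lgt0 ?subr_gt0 // jt_pos.
have [a [b [ab2 pE]]] := sum_product_pair 2 p.
have bE : b = 2 - a by rewrite ab2 addrC addKr.
have [rs [_ _ rs_real rs0]] := half_tmx_annihilator z.
set m := \prod_(r <- rs) ('X - r%:P) in rs0.
have := eigen_tmx_zpoly jtP ((('X - b%:P) * m)) (v := v) (a := a) (b := b).
rewrite -ab2 -pE => /(_ z vT vQ).
have -> : zpoly jt z (('X - b%:P) * m) = 0.
  by rewrite mulrC zpolyM /zpoly rs0 mulmx0 mul0mx.
rewrite (tmx0l jtP) mulmx0 => /esym/eqP; rewrite scaler_eq0 (negPf v0) orbF.
rewrite !hornerM !hornerXsubC subrr mul0r mulr0 addr0 !mulf_eq0.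
(* A real a would give p - 1 = - (1 - a)^2. *)
have no_real : a \isn't Num.real.
  apply/negP => a_real; have : p - 1 <= 0.
    rewrite pE bE (_ : _ - 1 = - (1 - a) ^+ 2); last by ring.
    by rewrite oppr_le0 -realEsqr rpredB // rpred1.
  by rewrite lt_geF // subr_gt0.
case/or3P => [/eqP a0|/eqP ab|].
- by move: no_real; rewrite a0 rpred0.
- have a1 : a = 1.
    have -> : a = ((a + b) + (a - b)) / 2 by field.
    by rewrite -ab2 ab addr0 divff // pnatr_eq0.
  by move: no_real; rewrite a1 rpred1.
by rewrite -/(root m a) root_prod_XsubC => /rs_real; rewrite (negPf no_real).
Qed.

End Positive.

(** * The duality map as an odd polynomial *)

Section Spectrum.
Variables (R : realType) (n' : nat).
Local Notation C := (R[i]).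
Local Notation V := ('rV[R[i]]_n'.+1).
Variable jt : V -> V -> V -> V.
Hypothesis jtP : hermitian_jts jt.
Hypothesis jt_pos : positive_jts jt.

(** On the span of the odd powers, [Q(z)^2] is the square of [S]; there
    [a = b]. *)
Lemma zpoly_qmx z p :
  zpoly jt z p *m qmx jt z = zpoly jt z p *m half_tmx jt z *m half_tmx jt z.
Proof.
have uF : zpoly jt z p *m tmx jt (odd_power jt z 1) z =
    2 *: (zpoly jt z p *m half_tmx jt z *m half_tmx jt z).
  rewrite -[odd_power jt z 1]zpolyXn (mul_zpoly_tmx jtP) mulrC zpolyM.
  by rewrite rmorphM rmorphXn expr1 /= horner_mx_X -mulmxE mulmxA.
rewrite /qmx -scalemxAr mulmxBr uF tmx_half expr2 -mulmxE mulmxA.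
move: (zpoly jt z p) (half_tmx jt z) => u S {uF}.
rewrite -scalemxAr -scalemxAr -scalemxAl scalerA -scalerBl scalerA.
by rewrite (_ : 2^-1 * _ = 1) ?scale1r //; field.
Qed.

(** Lagrange interpolation on the spectrum of [S] splits [z] into eigenvectors
    of [S], which are eigenvectors of [B(z,z)] for the eigenvalues
    [(1 - r)^2]. *)
Lemma symplectic_duality_zpoly z :
  (forall r, eigenvalue (half_tmx jt z) r -> r < 1) ->
  exists f, [/\ map_poly Num.conj f = f,
    symplectic_duality jt z = zpoly jt z f &
    zpoly jt z (f ^+ 2 * (1 - 'X) - 1) = 0].
Proof.
move=> S_lt1.
have [rs [rs_uniq rs_eigen rs_real rs0]] := half_tmx_annihilator jtP jt_pos z.
have kill p : {in rs, forall r, p.[r] = 0} -> zpoly jt z p = 0.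
  by move=> p0; rewrite /zpoly (horner_mx_eq0 rs_uniq rs0 p0) mulmx0.
(* The values that B(z,z)^(-1/4) takes on the eigenvectors. *)
pose g (r : C) : C := (((1 - complex.Re r) ^+ 2) `^ (- 4^-1))%:C%C.
pose L := lagrange_basis rs.
have reE r : r \in rs -> (complex.Re r)%:C%C = r by move=> /rs_real/RRe_real.
have g2 r : r \in rs -> g r ^+ 2 * (1 - r) = 1.
  move=> r_rs; rewrite /g -{2}(reE r r_rs) -(rmorph1 (real_complex R)).
  rewrite -rmorphXn -rmorphB -rmorphM /= powR_sqr_quarter //.
  have := S_lt1 r (rs_eigen r r_rs); rewrite -{1}(reE r r_rs).
  by rewrite -(rmorph1 (real_complex R)) ltcR subr_gt0.
exists (interpolant rs g); split.
- rewrite /interpolant rmorph_sum /= big_seq [RHS]big_seq.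
  apply: eq_bigr => r r_rs; rewrite map_polyZ /=.
  have -> : Num.conj (g r) = g r by exact: conjc_real.
  congr (_ *: _); rewrite /lagrange_basis rmorph_prod /=.
  rewrite big_seq_cond [RHS]big_seq_cond.
  apply: eq_bigr => s /andP[s_rs _].
  rewrite map_polyZ map_polyXsubC /=.
  have rC t : t \in rs -> Num.conj t = t by move=> /rs_real/CrealP.
  by rewrite fmorphV /= rmorphB /= !rC.
- have uS r : r \in rs ->
      zpoly jt z (L r) *m half_tmx jt z = r *: zpoly jt z (L r).
    move=> r_rs; apply/eqP; rewrite -subr_eq0.
    have <- : zpoly jt z (L r * ('X - r%:P)) = 0.
      apply: kill => t t_rs; rewrite hornerM hornerXsubC lagrange_basisE //.
      by have [->|_] := eqVneq t r; rewrite ?subrr ?mulr0 ?mul0r.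
    rewrite zpolyM rmorphB /= horner_mx_X horner_mx_C mulmxBr.
    by rewrite mul_mx_scalar.
  have zE : z = \sum_(r <- rs) zpoly jt z (L r).
    have : zpoly jt z ((\sum_(r <- rs) L r) - 1) = 0.
      apply: kill => t t_rs; rewrite hornerD hornerN hornerC horner_sum.
      have := interpolantE rs_uniq (fun=> 1) t_rs.
      rewrite /interpolant horner_sum.
      under eq_bigr do rewrite scale1r.
      by move=> ->; rewrite subrr.
    rewrite /zpoly rmorphB rmorph1 mulmxBr mulmx1 => /eqP.
    rewrite subr_eq0 => /eqP {1}<-.
    by rewrite rmorph_sum /= mulmx_sumr.
  rewrite /symplectic_duality {1}zE mulmx_suml /interpolant {2}/zpoly.
  rewrite rmorph_sum /= mulmx_sumr big_seq [RHS]big_seq.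
  apply: eq_bigr => r r_rs.
  rewrite linearZ /= -scalemxAr -/(zpoly jt z (L r)).
  apply: (@powmxP _ _ _ _ ((1 - complex.Re r) ^+ 2)).
    exact: bergman_linear.
  have uT : zpoly jt z (L r) *m tmx jt z z = (r + r) *: zpoly jt z (L r).
    by rewrite tmx_half -scalemxAr uS // scalerA mulr_natl mulr2n.
  have uQ : zpoly jt z (L r) *m qmx jt z = (r * r) *: zpoly jt z (L r).
    by rewrite zpoly_qmx uS // -scalemxAl uS // scalerA.
  rewrite -(mul_lin1_mx _ (bergman_linear jtP z z)) (eigen_bergman jtP uT uQ).
  congr (_ *: _); have reB : (1 - complex.Re r)%:C%C = 1 - r.
    by rewrite -{2}(reE r r_rs) -(rmorph1 (real_complex R)) -rmorphB.
  by rewrite -reB -expr2 -rmorphXn.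
apply: kill => r r_rs.
rewrite hornerD hornerN hornerM hornerD hornerN hornerX horner_exp hornerC.
by rewrite interpolantE // g2 // subrr.
Qed.

End Spectrum.

(** * Connected families of matrices without the eigenvalue zero *)

Section Topology.
Local Open Scope classical_set_scope.

Section ComplexContinuity.
Variables (R : realType) (T : topologicalType).
Implicit Types f g : T -> R[i].

Lemma continuousD_complex f g :
  continuous f -> continuous g -> continuous (fun x => f x + g x).
Proof. by move=> fc gc x; apply: (@cvgD _ (R[i])^o); [apply: fc|apply: gc]. Qed.

Lemma continuousM_complex f g :
  continuous f -> continuous g -> continuous (fun x => f x * g x).
Proof.
move=> fc gc x; apply: (@cvgM _ _ (nbhs x) _ (f : T -> (R[i])^o) g).
  exact: fc.
exact: gc.
Qed.

Lemma continuous_cst_complex (c : R[i]) : continuous (fun _ : T => c).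
Proof. by move=> x; exact: cvg_cst. Qed.

Lemma continuous_conj_complex f :
  continuous f -> continuous (fun x => Num.conj (f x)).
Proof.
move=> fc x; apply/(@cvgrPdist_lt R[i] (R[i])^o) => e e0.
have /(@cvgrPdist_lt R[i] (R[i])^o) /(_ e e0) := fc x.
apply: filterS => y; rewrite /= -rmorphB.
by rewrite [X in _ -> X < _](norm_conjC (f x - f y)).
Qed.

Lemma continuous_sum_complex (I : Type) (r : seq I) (f : I -> T -> R[i]) :
  (forall i, continuous (f i)) -> continuous (fun x => \sum_(i <- r) f i x).
Proof.
move=> fc; elim: r => [|i r IHr].
  by under eq_fun do rewrite big_nil; exact: continuous_cst_complex.
under eq_fun do rewrite big_cons.
exact: continuousD_complex (fc i) IHr.
Qed.

Lemma continuous_coef_prod (I : Type) (r : seq I) (p : I -> T -> {poly R[i]}) :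
  (forall i k, continuous (fun x => (p i x)`_k)) ->
  forall k, continuous (fun x => (\prod_(i <- r) p i x)`_k).
Proof.
move=> pc; elim: r => [|i r IHr] k.
  by under eq_fun do rewrite big_nil; exact: continuous_cst_complex.
under eq_fun do rewrite big_cons coefM.
apply: continuous_sum_complex => j.
exact: continuousM_complex (pc i j) (IHr _).
Qed.

Lemma continuous_char_poly n (G : T -> 'M[R[i]]_n) :
  (forall i j, continuous (fun x => G x i j)) ->
  forall k, continuous (fun x => (char_poly (G x))`_k).
Proof.
move=> Gc k; rewrite /char_poly /determinant; under eq_fun do rewrite coef_sum.
apply: continuous_sum_complex => s.
under eq_fun do rewrite -(rmorph_sign (@polyC R[i])) coefCM.
apply: continuousM_complex; first exact: continuous_cst_complex.
apply: continuous_coef_prod => i {}k.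
under eq_fun do rewrite !mxE coefB coefMn coefX coefC.
apply: continuousD_complex; first exact: continuous_cst_complex.
have [_|k0] := eqVneq k 0.
  under eq_fun do rewrite -mulN1r.
  apply: continuousM_complex; [exact: continuous_cst_complex|exact: Gc].
by rewrite oppr0; exact: continuous_cst_complex.
Qed.

End ComplexContinuity.

Lemma open_Re_gt0 (R : realType) : open [set c : R[i] | 0 < complex.Re c].
Proof.
rewrite openE => c /= c0; apply/(@nbhs_ballP R[i] (R[i])^o).
exists (complex.Re c)%:C%C => /=; first by rewrite ltcR.
move=> y /=; rewrite /ball /= => cy.
have := le_lt_trans (normc_ge_Re (c - y)) cy; rewrite ltcR.
move=> /(le_lt_trans (ler_norm _)); rewrite raddfB /= ltrBlDr ltrDl.
by [].
Qed.

Lemma closed_Re_ge0 (R : realType) : closed [set c : R[i] | 0 <= complex.Re c].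
Proof.
have -> : [set c : R[i] | 0 <= complex.Re c] =
    ~` ((fun c : R[i] => -1 * c) @^-1` [set c : R[i] | 0 < complex.Re c]).
  apply/seteqP; split=> c /=; rewrite mulN1r raddfN /= oppr_gt0 => c0.
    by apply/negP; rewrite -leNgt.
  by rewrite leNgt; apply/negP.
apply: open_closedC; apply: open_comp; last exact: open_Re_gt0.
move=> c _; apply: (@continuousM_complex R R[i] (fun=> -1) id).
  exact: continuous_cst_complex.
by move=> x; exact: cvg_id.
Qed.

(** Positivity of all the coefficients is the open condition by which negativity
    of the spectrum is detected below. *)
Lemma prod_XsubC_coef_gt0 (F : numDomainType) (rs : seq F) k :
  {in rs, forall r, r < 0} -> (k <= size rs)%N ->
  0 < (\prod_(r <- rs) ('X - r%:P))`_k.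
Proof.
elim: rs k => [|r rs IHrs] k rs_lt0 k_le.
  by move: k_le; rewrite leqn0 => /eqP->; rewrite big_nil coef1.
have r_lt0 : r < 0 by apply: rs_lt0; rewrite mem_head.
have {}IHrs j : (j <= size rs)%N -> 0 < (\prod_(r <- rs) ('X - r%:P))`_j.
  by apply: IHrs => s s_rs; apply: rs_lt0; rewrite inE s_rs orbT.
rewrite big_cons mulrBl coefB coefXM coefCM.
have c_ge0 : 0 <= - (r * (\prod_(s <- rs) ('X - s%:P))`_k).
  rewrite -mulNr mulr_ge0 ?oppr_ge0 ?(ltW r_lt0) //.
  have [/IHrs/ltW //|k_gt] := leqP k (size rs).
  by rewrite nth_default // (size_prod_XsubC rs id).
case: k k_le c_ge0 => [_ _|k k_le c_ge0] /=.
  by rewrite sub0r -mulNr mulr_gt0 ?oppr_gt0 ?IHrs.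
by rewrite ltr_wpDr // IHrs.
Qed.

(** As the eigenvalues are real and nonzero, the three conditions that they are
    all negative, that the characteristic polynomial has positive coefficients,
    and that it has nonnegative coefficients are equivalent on [A]. The second
    is open and the third is closed. *)
Lemma negative_spectrum_connected (R : realType) (T : topologicalType) n
    (G : T -> 'M[R[i]]_n) (A : set T) x0 x :
  (forall i j, continuous (fun u => G u i j)) -> connected A ->
  (forall u, A u -> forall r, eigenvalue (G u) r -> r \is Num.real /\ r != 0) ->
  A x0 -> (forall r, eigenvalue (G x0) r -> r < 0) ->
  A x -> forall r, eigenvalue (G x) r -> r < 0.
Proof.
move=> Gc A_conn G_real Ax0 G0 Ax.
pose c k u := complex.Re (char_poly (G u))`_k.
pose U := [set u | forall k : 'I_n.+1, 0 < c k u].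
pose K := [set u | forall k : 'I_n.+1, 0 <= c k u].
have negU u : (forall r, eigenvalue (G u) r -> r < 0) -> U u.
  move=> neg k; have [rs rsE] := closed_field_poly_normal (char_poly (G u)).
  rewrite (monicP (char_poly_monic (G u))) scale1r in rsE.
  have szE : size rs = n.
    by apply/eqP; rewrite -eqSS -(size_prod_XsubC rs id) -rsE size_char_poly.
  have : 0 < (char_poly (G u))`_k.
    rewrite rsE prod_XsubC_coef_gt0 ?szE -1?ltnS // => r r_rs; apply: neg.
    by rewrite eigenvalue_root_char rsE root_prod_XsubC.
  by rewrite ltcE => /andP[].
have Kneg u : A u -> K u -> forall r, eigenvalue (G u) r -> r < 0.
  move=> Au Ku r r_eigen; have [r_real r0] := G_real u Au r r_eigen.
  rewrite real_ltNge ?rpred0 //; apply/negP => r_ge0.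
  have rE := RRe_real r_real; set t := complex.Re r in rE.
  have t_gt0 : 0 < t.
    by rewrite -ltcR rE lt_neqAle eq_sym r0.
  move: r_eigen; rewrite eigenvalue_root_char /root horner_coef size_char_poly.
  move=> /eqP/(congr1 (@complex.Re R)); apply/eqP.
  rewrite gt_eqF // raddf_sum /=.
  have termE (k : 'I_n.+1) :
      complex.Re ((char_poly (G u))`_k * r ^+ k) = c k u * t ^+ k.
    rewrite -rE -rmorphXn /c; case: (char_poly (G u))`_k => a b /=.
    by rewrite mulr0 subr0.
  rewrite (bigD1 ord_max) //= ltr_pwDl //.
    rewrite (termE ord_max) mulr_gt0 ?exprn_gt0 // /c /=.
    have := monicP (char_poly_monic (G u)).
    by rewrite lead_coefE size_char_poly /= => ->; rewrite ltr01.
  apply: sumr_ge0 => k _; rewrite termE.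
  by apply: mulr_ge0; [exact: Ku|exact/exprn_ge0/ltW].
have AUK : A `&` U = A `&` K.
  apply/seteqP; split=> v [Av vP]; split=> //; first by move=> k; exact/ltW/vP.
  by apply: negU; exact: Kneg.
have cc k : continuous (fun u => (char_poly (G u))`_k).
  exact: continuous_char_poly.
have UA : A `&` U = A.
  apply: A_conn.
  - by exists x0; split=> //; exact: negU.
  - exists U => //; rewrite openE => u Uu; apply: filter_forall => k.
    exact: (cc k u _ (open_nbhs_nbhs (conj (@open_Re_gt0 R) (Uu k)))).
  exists K => //.
  have -> : K = \bigcap_(k in [set: 'I_n.+1])
      ((fun u => (char_poly (G u))`_k) @^-1`
        [set z : R[i] | 0 <= complex.Re z]).
    by apply/seteqP; split=> [u Ku k _|u Ku k]; [exact: Ku|exact: (Ku k I)].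
  apply: closed_bigI => k _; apply: closed_comp; last exact: closed_Re_ge0.
  by move=> u _; exact: cc.
apply: Kneg => //.
have : (A `&` K) x by rewrite -AUK UA.
by case.
Qed.

Lemma continuous_tmx_diag (R : realType) n'
    (V := 'rV[R[i]]_n'.+1) (jt : V -> V -> V -> V) :
  hermitian_jts jt ->
  forall i j, continuous (fun u => tmx jt u u i j).
Proof.
move=> jtP i j; have expand u : tmx jt u u = \sum_a \sum_b
    u 0 a *: (Num.conj (u 0 b) *: tmx jt (delta_mx 0 a) (delta_mx 0 b)).
  have sumr (I : Type) (r : seq I) x (y : I -> 'rV[R[i]]_n'.+1) :
      tmx jt x (\sum_(k <- r) y k) = \sum_(k <- r) tmx jt x (y k).
    elim: r => [|k r IHr]; last by rewrite !big_cons (tmxDr jtP) IHr.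
    by rewrite !big_nil (tmx0r jtP).
  have suml (I : Type) (r : seq I) (x : I -> 'rV[R[i]]_n'.+1) y :
      tmx jt (\sum_(k <- r) x k) y = \sum_(k <- r) tmx jt (x k) y.
    elim: r => [|k r IHr]; last by rewrite !big_cons (tmxDl jtP) IHr.
    by rewrite !big_nil (tmx0l jtP).
  rewrite {1 2}(row_sum_delta u) suml; apply: eq_bigr => a _.
  rewrite (tmxZl jtP) sumr scaler_sumr; apply: eq_bigr => b _.
  by rewrite (tmxZr jtP).
under eq_fun do rewrite expand summxE.
apply: continuous_sum_complex => a; under eq_fun do rewrite summxE.
apply: continuous_sum_complex => b; under eq_fun do rewrite 2!mxE.
have coord k : continuous (fun u : 'rV[R[i]]_n'.+1 => u 0 k).
  exact: (@coord_continuous R[i] 1 n'.+1 0 k).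
apply: continuousM_complex; first exact: coord.
apply: continuousM_complex; last exact: continuous_cst_complex.
exact: continuous_conj_complex.
Qed.

(** Apply [negative_spectrum_connected] to [S - 1] on a connected set of
    points where [B] is positive that contains both [0] and [z]. *)
Lemma symdomain_eigenvalue_lt1 (R : realType) n'
    (V := 'rV[R[i]]_n'.+1) (jt : V -> V -> V -> V) z :
  hermitian_jts jt -> positive_jts jt -> symdomain jt z ->
  forall r, eigenvalue (half_tmx jt z) r -> r < 1.
Proof.
move=> jtP jt_pos [A [A0 A_pos A_conn] Az] r r_eigen.
have half_real u s : eigenvalue (half_tmx jt u) s -> s \is Num.real.
  exact: (selfadjoint_eigenvalue_real (trform_linear jtP)
    (trform_antilinear jtP) jt_pos (selfadjoint_half_tmx jtP u)).
rewrite -subr_lt0.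
apply: (@negative_spectrum_connected _ _ _ (fun u => half_tmx jt u - 1) A 0 z)
  => [i j||u Au s||s||].
- have entryE u : (half_tmx jt u - 1) i j =
      2^-1 * tmx jt u u i j + (- 1%:M : 'M[R[i]]_(n'.+1)) i j.
    by rewrite /half_tmx; move: (tmx jt u u) => X; rewrite !mxE.
  under eq_fun do rewrite entryE.
  apply: continuousD_complex; last exact: continuous_cst_complex.
  apply: continuousM_complex; first exact: continuous_cst_complex.
  exact: continuous_tmx_diag.
- exact: A_conn.
- rewrite eigenvalue_subr1 => s_eigen; split.
    by rewrite -(addrK 1 s) rpredB ?rpred1 // (half_real u).
  apply/eqP => s0; move: s_eigen; rewrite s0 add0r.
  exact/negP/(posdef_bergman_eigenvalue jtP jt_pos)/A_pos.
- exact: A0.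
- rewrite eigenvalue_subr1 => /eigenvalueP[v vE v0].
  have : (s + 1) *: v = 0.
    rewrite -vE /half_tmx -scalemxAr (mul_tmx jtP) (jt0l jtP).
    by rewrite scaler0.
  move/eqP; rewrite scaler_eq0 (negPf v0) orbF addr_eq0 => /eqP->.
  exact: ltrN10.
- exact: Az.
by rewrite eigenvalue_subr1 subrK.
Qed.

End Topology.

(** * Duality of the kernels *)

Theorem theorem5 (R : realType) (n : nat)
    (jt : 'rV[R[i]]_n -> 'rV[R[i]]_n -> 'rV[R[i]]_n -> 'rV[R[i]]_n)
    (jtP : hermitian_jts jt) (jt_pos : positive_jts jt)
    (z : 'rV[R[i]]_n) (Mz : symdomain jt z) :
  dual_kernel jt (symplectic_duality jt z) = reproducing_kernel jt z z.
Proof.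
case: n jt jtP jt_pos z Mz => [|n] jt jtP jt_pos z Mz.
  (* In dimension 0 every determinant is 1. *)
  have K1 x y : reproducing_kernel jt x y = 1.
    by rewrite /reproducing_kernel det_mx00 invr1.
  by rewrite /dual_kernel !K1 invr1.
have [f [f_real wE f0]] :=
  symplectic_duality_zpoly jtP jt_pos (symdomain_eigenvalue_lt1 jtP jt_pos Mz).
have BB := bergman_zpoly_det jtP f_real f0.
rewrite /dual_kernel /reproducing_kernel wE invrK.
apply: (can_inj (@invrK _)); rewrite invrK; exact: mulr1_eq BB.
Qed.
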